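(* For any positive integer $n$, $$\sum_{|\lambda|=n}(f^{\lambda})^2\prod_{1\le i\le n}\frac{(n+i)!}{(n+i-\lambda_i)!}=(n+1)^n\,n!,$$ where the sum runs over all partitions $\lambda=(\lambda_1,\dots,\lambda_n)$ of $n$.
   Context: A partition $\lambda=(\lambda_1,\dots,\lambda_n)$ of $n$ is a sequence of integers $\lambda_1\ge\dots\ge\lambda_n\ge0$ with $|\lambda|=\sum_i\lambda_i=n$. $f^{\lambda}$ is the number of standard Young tableaux of shape $\lambda$. *)

(* Defs.v *)
From HB Require Import structures.
From mathcomp Require Import all_boot all_order all_algebra.

Set Implicit Arguments.
Unset Strict Implicit.
Unset Printing Implicit Defensive.

(* Indices are shifted by one: [l i] is the part lambda_(i+1).  A part of a
   partition of n is at most n, so taking the values in 'I_n.+1 loses nothing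
   and makes the set of partitions finite. *)
Definition is_partition (n : nat) (l : {ffun 'I_n -> 'I_n.+1}) : bool :=
  [forall i : 'I_n, forall j : 'I_n, (i <= j) ==> (l j <= l i)]
  && (\sum_(i < n) l i == n).

(* Cells (row, column) of the Young diagram; since l <= n pointwise, both
   coordinates (counted from 0) range over 'I_n. *)
Definition in_diagram (n : nat) (l : {ffun 'I_n -> 'I_n.+1}) :
    pred ('I_n * 'I_n) :=
  fun c => c.2 < l c.1.

Definition cell (n : nat) (l : {ffun 'I_n -> 'I_n.+1}) : finType :=
  {c : 'I_n * 'I_n | in_diagram l c}.

(* The entry k of a tableau is represented by k - 1, an element of 'I_n. *)
Definition is_standard (n : nat) (l : {ffun 'I_n -> 'I_n.+1})
    (T : {ffun cell l -> 'I_n}) : bool :=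
  [&& injectiveb T,
      [forall k : 'I_n, exists c : cell l, T c == k],
      [forall c : cell l, forall d : cell l,
         ((val c).1 == (val d).1) && ((val c).2 < (val d).2) ==> (T c < T d)]
    & [forall c : cell l, forall d : cell l,
         ((val c).2 == (val d).2) && ((val c).1 < (val d).1) ==> (T c < T d)]].

Definition num_syt (n : nat) (l : {ffun 'I_n -> 'I_n.+1}) : nat :=
  #|[set T : {ffun cell l -> 'I_n} | is_standard T]|.

(* Main.v *)
Require Import Defs.
From HB Require Import structures.
From mathcomp Require Import all_boot all_order all_algebra.
From mathcomp Require Import zify ring.
Import Order.TTheory GRing.Theory Num.Theory.
Local Open Scope ring_scope.

(** Let f(l) be the number of standard Young tableaux of shape l, let |l| be
    the number of boxes, and give the box in row i and column k (both counted
    from 0) the weight x + i - k.  For all m the identity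
      sum over |l| = m of f(l)^2 * (product of the weights of l) = m! x^m
    holds; at x = n + 1 and m = n, the weights of row i multiply to the
    quotient (n+i+1)! / (n+i+1-l_i)!, so this is the desired formula.

    The identity goes by induction on m, along the inclusion order of Young
    diagrams.  In f(l)^2 expand one factor by the branching rule [branching]:
    f(l) is the sum of f over the shapes obtained by removing a corner from l
    (the corner occupied by the largest entry).  Exchanging the summations, the
    step from m to m + 1 amounts to [weighted_branching_up]:
      sum over addable boxes b of l of weight(b) f(l + b) = x (|l| + 1) f(l).

    This in turn is proved by induction on |l|.  Expand each f(l + b) by the
    branching rule.  Removing b itself returns to l; removing another corner c
    commutes with adding b ([addable_exchange]), and the terms with a given c
    form the sum for the smaller shape l - c, except for its term b = c.  The
    induction hypothesis evaluates the former to x |l| f(l) altogether, and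
    what is left is f(l) times
      (weights of the addable boxes) - (weights of the removable boxes),
    which is x for every partition ([content_balance]): the addable box of row
    i + 1 and the removable box of row i exist simultaneously, and the
    difference of their weights is l_i - l_(i+1), so the sum telescopes. *)

Set Implicit Arguments.
Unset Strict Implicit.
Unset Printing Implicit Defensive.

(** * Adding and removing boxes *)

Section Shapes.
Variable N : nat.
Implicit Types (l : {ffun 'I_N -> 'I_N.+1}) (i j k : 'I_N).

Definition noninc l : bool :=
  [forall i : 'I_N, forall j : 'I_N, (i <= j)%N ==> (l j <= l i)%N].

Definition num_boxes l : nat := (\sum_(i < N) l i)%N.

(** Addition in {ffun 'I_N -> 'I_N.+1} is modulo N + 1 in every row.  Hence
    adding a box to row i is a translation, which makes sums over shapes easy
    to reindex; the last condition of [addable] excludes the wraparound. *)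
Definition box i : {ffun 'I_N -> 'I_N.+1} := [ffun j => inord (j == i)].

Definition addable l i : bool := [&& noninc l, noninc (l + box i) & (l i < N)%N].

Lemma nonincP l :
  reflect (forall i j, (i <= j)%N -> (l j <= l i)%N) (noninc l).
Proof.
apply: (iffP forallP) => [H i j ij|H i]; first by have /forallP/(_ j)/implyP := H i; apply.
by apply/forallP => j; apply/implyP; apply: H.
Qed.

Lemma add_boxE l i j : (l i < N)%N -> (l + box i) j = (l j + (j == i))%N :> nat.
Proof.
move=> li; have N0 : (0 < N)%N := leq_ltn_trans (leq0n i) (ltn_ord i).
rewrite !ffunE /= inordK; last by case: (j == i).
have [->|_] := eqVneq j i; rewrite modn_small //; first by lia.
by rewrite addn0.
Qed.

Lemma sub_boxE l i j : (0 < l i)%N -> (l - box i) j = (l j - (j == i))%N :> nat.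
Proof.
move=> li; have N0 : (0 < N)%N := leq_ltn_trans (leq0n i) (ltn_ord i).
rewrite !ffunE /= inordK; last by case: (j == i).
have [->|_] := eqVneq j i.
  rewrite subn1 /= (@modn_small N) // -{1}(prednK li) addSnnS modnDr subn1.
  by rewrite modn_small // (leq_ltn_trans (leq_pred _) (ltn_ord _)).
by rewrite subn0 modnn addn0 modn_small // subn0.
Qed.

Lemma num_boxes_add_box l i : (l i < N)%N -> num_boxes (l + box i) = (num_boxes l).+1.
Proof.
move=> li; rewrite /num_boxes (eq_bigr (fun j => l j + (j == i))%N); last first.
  by move=> j _; rewrite add_boxE.
rewrite big_split /= -[RHS]addn1; congr addn.
by rewrite (bigD1 i) //= eqxx big1 // => j /negbTE->.
Qed.

Lemma leq_num_boxes l i : (l i <= num_boxes l)%N.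
Proof. by rewrite /num_boxes (bigD1 i) //= leq_addr. Qed.

Lemma num_boxes_addable l i : addable l i -> num_boxes (l + box i) = (num_boxes l).+1.
Proof. by case/and3P=> _ _; apply: num_boxes_add_box. Qed.

(** Row by row, l + box i and l - box j are the maximum and the minimum of l
    and l + box i - box j, and these preserve monotonicity. *)
Lemma addable_exchange l i j : i != j ->
  noninc l ->
  addable l i && addable (l + box i - box j) j =
  addable (l - box j) j && addable (l - box j) i.
Proof.
move=> ij nl; set k : {ffun 'I_N -> 'I_N.+1} := l - box j.
have lE : l = k + box j by rewrite /k subrK.
have nuE : l + box i - box j = k + box i by rewrite /k addrAC.
clearbody k; rewrite nuE /addable -lE nl /=.
have -> : k + box i + box j = l + box i by rewrite lE addrAC.
have klt : (l i < N)%N = (k i < N)%N.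
  rewrite lE !ffunE (negbTE ij) /= inordK // addn0 modn_small //.
have klt2 : ((k + box i)%R j < N)%N = (k j < N)%N.
  by rewrite !ffunE [j == i]eq_sym (negbTE ij) /= inordK // addn0 modn_small.
rewrite klt klt2; case: (ltnP (k i) N) => [ki|]; last by rewrite !andbF.
case: (ltnP (k j) N) => [kj|]; last by rewrite !andbF.
rewrite !andbT; case: (boolP (noninc (k + box i))) => [nn|_]; last by rewrite !andbF.
rewrite ?andbT /=.
have vl a : l a = (k a + (a == j))%N :> nat by rewrite lE add_boxE.
have vn a : (k + box i) a = (k a + (a == i))%N :> nat by rewrite add_boxE.
have vm a : (l + box i) a = (k a + (a == j) + (a == i))%N :> nat.
  by rewrite add_boxE ?vl // (negbTE ij) addn0.
have dj a : (a == i) && (a == j) = false.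
  by apply/negbTE/negP => /andP[/eqP-> /eqP E]; rewrite E eqxx in ij.
move/nonincP: nl => nl; move/nonincP: nn => nn.
have -> : noninc (l + box i).
  apply/nonincP => a b ab; rewrite !vm.
  have := nl _ _ ab; have := nn _ _ ab; rewrite !vl !vn; have := dj b.
  by case: (b == i); case: (b == j); case: (a == i); case: (a == j) => //=; lia.
suff -> : noninc k by [].
apply/nonincP => a b ab.
have := nl _ _ ab; have := nn _ _ ab; rewrite !vl !vn; have := dj a.
by case: (b == i); case: (b == j); case: (a == i); case: (a == j) => //=; lia.
Qed.

(** The default 0 beyond the last row lets the telescoping sum run over the
    natural numbers. *)
Definition row_length l (r : nat) : nat := oapp (fun i => l i : nat) 0%N (insub r).

Lemma row_length_ord l i : row_length l i = l i.
Proof. by rewrite /row_length insubT //= => H; congr (nat_of_ord (l _)); apply: val_inj. Qed.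

Lemma row_length_ge l r : (N <= r)%N -> row_length l r = 0%N.
Proof. by rewrite /row_length; case: insubP => //= u; rewrite ltnNge => /negbTE->. Qed.

(** The bound on the number of boxes ensures that adding a box to row 0 stays
    within the range of the row lengths. *)
Lemma addableE l i : noninc l -> (num_boxes l < N)%N ->
  addable l i = (i == 0 :> nat) || (row_length l i < row_length l i.-1)%N.
Proof.
move=> nl sl; have li : (l i < N)%N := leq_ltn_trans (leq_num_boxes l i) sl.
rewrite /addable nl li andbT /= row_length_ord; apply/nonincP/orP => [H|H a b ab].
  case: (posnP i) => [->|i0]; first by left.
  have h : (i.-1 < N)%N by have := ltn_ord i; lia.
  right; have := H (Ordinal h) i (leq_pred _); rewrite !add_boxE // eqxx.
  have -> : (Ordinal h == i) = false by rewrite -val_eqE /=; lia.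
  by rewrite -(row_length_ord l (Ordinal h)) /=; lia.
rewrite !add_boxE //; move/nonincP: nl => nl; have := nl _ _ ab.
have [->|ne] := eqVneq a i; first by case: (b == i); lia.
have [bi|] := eqVneq b i; last by lia.
rewrite -val_eqE /= in ne; subst b.
case: H => [/eqP H|]; first by lia.
have h : (i.-1 < N)%N by have := ltn_ord i; lia.
have /nl : (a <= Ordinal h)%N by rewrite /=; lia.
by rewrite -(row_length_ord l (Ordinal h)) /=; lia.
Qed.

Lemma removableE l i : noninc l ->
  addable (l - box i) i = (row_length l i.+1 < row_length l i)%N.
Proof.
move=> nl; rewrite /addable subrK nl /= row_length_ord; apply/andP/idP => [[H ki]|H].
  have li : l i = ((l - box i)%R i).+1 :> nat.
    by rewrite -{1}(subrK (box i) l) add_boxE // eqxx addn1.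
  case: (ltnP i.+1 N) => [h|/row_length_ge->]; last by lia.
  move/nonincP: H => /(_ i (Ordinal h) (leqnSn _)).
  rewrite sub_boxE; last by lia.
  have -> : (Ordinal h == i) = false by rewrite -val_eqE /=; lia.
  by rewrite subn0 -(row_length_ord l (Ordinal h)) /= => H; rewrite li ltnS.
have l0 : (0 < l i)%N by lia.
split; last by rewrite sub_boxE // eqxx; have := ltn_ord (l i); lia.
move/nonincP: nl => nl; apply/nonincP => a b ab; rewrite !sub_boxE //.
have := nl _ _ ab.
have [bi|nb] := eqVneq b i; first by subst b; case: (a == i); lia.
have [ai|] := eqVneq a i; last by lia.
rewrite -val_eqE /= in nb; subst a.
have h : (i.+1 < N)%N by have := ltn_ord b; lia.
have /nl : (Ordinal h <= b)%N by rewrite /=; lia.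
by rewrite -(row_length_ord l (Ordinal h)) /=; lia.
Qed.

Lemma last_row_empty l : noninc l -> (num_boxes l < N)%N -> row_length l N.-1 = 0%N.
Proof.
move=> /nonincP nl sl; have h : (N.-1 < N)%N by lia.
apply/eqP; rewrite -leqn0 leqNgt; apply/negP => H; move: sl; rewrite ltnNge.
case/negP; rewrite /num_boxes -{1}[N]card_ord -sum1_card; apply: leq_sum => i _.
apply: leq_trans H _; have /nl : (i <= Ordinal h)%N by have := ltn_ord i; rewrite /=; lia.
by rewrite -(row_length_ord l (Ordinal h)).
Qed.

Section Weight.
Variables (R : comNzRingType) (x : R).

Definition weight l i : R := x + i%:R - (l i)%:R.

(** The corners of a partition interlace: row i + 1 has an addable box exactly
    when row i has a removable one.  These pairs contribute l_i - l_(i+1), and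
    row 0 contributes x - l_0.  With fewer than N boxes the last row is empty,
    so that nothing is lost at the lower end. *)
Lemma content_balance l : noninc l -> (num_boxes l < N)%N ->
  \sum_(i | addable l i) weight l i
  - \sum_(i | addable (l - box i) i) weight (l - box i) i = x.
Proof.
move=> nl sl.
rewrite (eq_bigl (fun i => (i == 0 :> nat) || (row_length l i < row_length l i.-1)%N)); last first.
  by move=> i; rewrite addableE.
rewrite [X in _ - X](eq_bigl (fun i => (row_length l i.+1 < row_length l i)%N)); last first.
  by move=> i; rewrite removableE.
rewrite (eq_bigr (fun i => x + (i : nat)%:R - (row_length l i)%:R)); last first.
  by move=> i _; rewrite /weight row_length_ord.
rewrite [X in _ - X](eq_bigr (fun i => x + (i : nat)%:R - (row_length l i)%:R + 1)); last first.
  move=> i; rewrite row_length_ord => H; rewrite /weight sub_boxE; last by lia.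
  by rewrite eqxx natrB /=; [ring|lia].
rewrite big_mkcond [X in _ - X]big_mkcond /=.
rewrite -(big_mkord xpredT (fun i : nat => if (i == 0)%N || (row_length l i < row_length l i.-1)%N
  then x + i%:R - (row_length l i)%:R else 0)).
rewrite -(big_mkord xpredT (fun i : nat => if (row_length l i.+1 < row_length l i)%N
  then x + i%:R - (row_length l i)%:R + 1 else 0)).
have lst := last_row_empty nl sl.
have mono r : (r.+1 < N)%N -> (row_length l r.+1 <= row_length l r)%N.
  move=> h; have h' : (r < N)%N by lia.
  have := (nonincP _ nl) (Ordinal h') (Ordinal h) (leqnSn _).
  by rewrite -!row_length_ord.
have Npos : N = N.-1.+1 by lia.
rewrite Npos big_nat_recl // big_nat_recr //= lst /= !addr0.
rewrite -addrA -sumrB.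
rewrite (eq_big_nat _ _
  (F2 := fun i : nat => - (row_length l i.+1)%:R - - (row_length l i)%:R)); last first.
  move=> i hi; have := mono i ltac:(lia); rewrite leq_eqVlt => /orP[/eqP->|->].
    by rewrite ltnn; ring.
  by rewrite -natr1; ring.
by rewrite telescope_sumr // lst; ring.
Qed.
End Weight.
End Shapes.

(** * The branching rule for standard tableaux *)

Section Tableaux.
Variable N : nat.
Notation shape := {ffun 'I_N -> 'I_N.+1}.
Notation filling := {ffun 'I_N * 'I_N -> 'I_N.+1}.
Implicit Types (l : shape) (i j k : 'I_N) (c d : 'I_N * 'I_N) (T : filling).

Definition before c d : bool :=
  ((c.1 == d.1) && (c.2 < d.2)%N) || ((c.2 == d.2) && (c.1 < d.1)%N).

(** Fillings are defined on the whole square, with the value N outside the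
    diagram, so that tableaux of different shapes live in the same type and
    a box can be removed by resetting its entry to N. *)
Definition standard l T : bool :=
  [&& [forall c, if in_diagram l c then (T c < num_boxes l)%N else T c == ord_max],
      [forall k : 'I_N, (k < num_boxes l)%N ==> [exists c, T c == k :> nat]],
      [forall c, forall d, [&& in_diagram l c, in_diagram l d & T c == T d] ==> (c == d)]
    & [forall c, forall d, [&& in_diagram l c, in_diagram l d & before c d] ==> (T c < T d)%N]].

Definition num_standard l : nat := #|[set T | standard l T]|.

Lemma standardP l T :
  reflect
    [/\ forall c, in_diagram l c -> (T c < num_boxes l)%N,
        forall c, ~~ in_diagram l c -> T c = ord_max,
        forall k, (k < num_boxes l)%N -> exists c, T c = k :> nat,
        forall c d, in_diagram l c -> in_diagram l d -> T c = T d -> c = d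
      & forall c d, in_diagram l c -> in_diagram l d -> before c d -> (T c < T d)%N]
    (standard l T).
Proof.
apply: (iffP and4P) => [[H1 H2 H3 H4]|[H1 H2 H3 H4 H5]]; split.
- by move=> c dc; have /forallP/(_ c) := H1; rewrite dc.
- by move=> c dc; have /forallP/(_ c) := H1; rewrite (negbTE dc) => /eqP.
- move=> k kl; have /forallP/(_ k)/implyP/(_ kl)/existsP[c /eqP] := H2; by exists c.
- move=> c d dc dd E; have /forallP/(_ c)/forallP/(_ d)/implyP := H3.
  by rewrite dc dd E eqxx => /(_ isT)/eqP.
- move=> c d dc dd E; have /forallP/(_ c)/forallP/(_ d)/implyP := H4.
  by rewrite dc dd E => /(_ isT).
- by apply/forallP => c; case: ifP => [/H1//|/negbT/H2->].
- apply/forallP => k; apply/implyP => /H3[c E]; apply/existsP; exists c; exact/eqP.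
- apply/forallP => c; apply/forallP => d; apply/implyP => /and3P[dc dd /eqP E].
  by apply/eqP; apply: H4.
- apply/forallP => c; apply/forallP => d; apply/implyP => /and3P[dc dd E].
  exact: H5.
Qed.

Definition set_entry T c (v : 'I_N.+1) : filling := [ffun d => if d == c then v else T d].

Lemma in_diagram_add_box l i c : (l i < N)%N ->
  in_diagram (l + box i) c =
  in_diagram l c || ((c.1 == i) && (c.2 == l i :> nat)).
Proof.
move=> li; rewrite /in_diagram add_boxE //.
by case: eqP => [->|]; rewrite ?addn1 ?addn0 ?orbF ?andbT //= ltnS leq_eqVlt orbC.
Qed.

Lemma standard_add_box l i (h : (l i < N)%N) (m : 'I_N.+1) T :
  addable l i -> m = num_boxes l :> nat ->
  (num_boxes l < N)%N ->
  standard l T -> standard (l + box i) (set_entry T (i, Ordinal h) m).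
Proof.
move=> g mE sl /standardP[Hin Hout Hsurj Hinj Hinc].
have sz := num_boxes_addable g.
have dE c : in_diagram (l + box i) c = in_diagram l c || (c == (i, Ordinal h)).
  by rewrite in_diagram_add_box //; case: c => a b; rewrite xpair_eqE.
have dcn : in_diagram l (i, Ordinal h) = false by rewrite /in_diagram /= ltnn.
apply/standardP; split.
- move=> c; rewrite dE ffunE sz; case: eqP => [_ _|_]; first by rewrite mE.
  by rewrite orbF => /Hin H; rewrite ltnS ltnW.
- by move=> c; rewrite dE ffunE; case: eqP => // _; rewrite ?orbT ?orbF // => /Hout.
- move=> k; rewrite sz ltnS leq_eqVlt => /orP[/eqP->|kl].
    by exists (i, Ordinal h); rewrite ffunE eqxx.
  have [c E] := Hsurj k kl; exists c; rewrite ffunE; case: eqP => // Ec.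
  by move: E; rewrite Ec Hout ?dcn //= => E; have := ltn_ord k; rewrite -E ltnn.
- move=> c d; rewrite !dE !ffunE.
  case: eqP => [->|_]; case: eqP => [->|_] //; rewrite ?orbF ?orbT //.
  + by move=> _ /Hin H /(congr1 val) /= E; move: H; rewrite -E mE ltnn.
  + by move=> /Hin H _ /(congr1 val) /= E; move: H; rewrite E mE ltnn.
  exact: Hinj.
- case/and3P: (g) => /nonincP nl /nonincP nu _.
  move=> c d; rewrite !dE !ffunE.
  case: eqP => [->|_]; case: eqP => [->|_] //; rewrite ?orbF ?orbT //.
  + by rewrite /before /= !ltnn !andbF.
  + move=> _; rewrite /before /in_diagram /= => dd /orP[] /andP[/eqP E H].
      by move: dd H; rewrite -E; lia.
    by move: dd; rewrite -E /=; have := nl _ _ (ltnW H); lia.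
  + by move=> /Hin H _ _; rewrite mE.
  exact: Hinc.
Qed.

(** Injectivity of the filling guarantees that the other entries stay below the
    removed one, the largest. *)
Lemma standard_del_box l i (h : (l i < N)%N) (m : 'I_N.+1) T :
  addable l i -> m = num_boxes l :> nat ->
  (num_boxes l < N)%N ->
  standard (l + box i) T -> T (i, Ordinal h) = m -> standard l (set_entry T (i, Ordinal h) ord_max).
Proof.
move=> g mE sl /standardP[Hin Hout Hsurj Hinj Hinc] Tm.
have sz := num_boxes_addable g.
have dE c : in_diagram (l + box i) c = in_diagram l c || (c == (i, Ordinal h)).
  by rewrite in_diagram_add_box //; case: c => a b; rewrite xpair_eqE.
have dcn : in_diagram l (i, Ordinal h) = false by rewrite /in_diagram /= ltnn.
have dne c : in_diagram l c -> (c == (i, Ordinal h)) = false.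
  by move=> dc; apply/negbTE/eqP => E; rewrite E dcn in dc.
have dcu : in_diagram (l + box i) (i, Ordinal h) by rewrite dE eqxx orbT.
have sub c : in_diagram l c -> in_diagram (l + box i) c by rewrite dE => ->.
apply/standardP; split.
- move=> c dc; rewrite ffunE dne //.
  have := Hin c (sub _ dc); rewrite sz ltnS leq_eqVlt => /orP[/eqP E|//].
  have /eqP : c = (i, Ordinal h)
    by apply: Hinj => //; [exact: sub|rewrite Tm; apply: val_inj; rewrite /= E mE].
  by rewrite dne.
- move=> c dc; rewrite ffunE; case: eqP => // /eqP/negbTE E.
  by apply: Hout; rewrite dE (negbTE dc) E.
- move=> k kl; have [|c E] := Hsurj k; first by rewrite sz ltnS ltnW.
  exists c; rewrite ffunE; case: eqP => // Ec.
  by move: E; rewrite Ec Tm mE => E; rewrite -E ltnn in kl.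
- move=> c d dc dd; rewrite !ffunE !dne //; apply: Hinj; exact: sub.
- move=> c d dc dd; rewrite !ffunE !dne //; apply: Hinc; exact: sub.
Qed.

(** A box to the right of the largest entry, or below it, would have to hold a
    larger one. *)
Lemma max_corner l (m : 'I_N.+1) T c : noninc l -> num_boxes l = m.+1 -> (m < N)%N ->
  standard l T -> T c = m ->
  addable (l - box c.1) c.1 && (c.2 == (l - box c.1) c.1 :> nat).
Proof.
move=> nl sz mN /standardP[Hin Hout Hsurj Hinj Hinc] Tm.
have dc : in_diagram l c.
  by case: (boolP (in_diagram l c)) => // /Hout; rewrite Tm => E; rewrite E ltnn in mN.
have top d : in_diagram l d -> before c d -> False.
  by move=> dd bd; have := Hinc _ _ dc dd bd; have := Hin _ dd; rewrite Tm sz; lia.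
have E : (c.2).+1 = l c.1 :> nat.
  apply/eqP; rewrite eqn_leq [(_ < _)%N]dc /= leqNgt; apply/negP => H.
  have h : ((c.2).+1 < N)%N by have := ltn_ord (l c.1); lia.
  by apply: (top (c.1, Ordinal h)); rewrite /in_diagram /before /= ?eqxx ?ltnSn.
rewrite sub_boxE; last by lia.
rewrite eqxx subn1 -E /= eqxx andbT removableE // row_length_ord.
case: (ltnP (c.1).+1 N) => [h|/row_length_ge->]; last by lia.
rewrite -[(c.1).+1]/(val (Ordinal h)) row_length_ord ltnNge; apply/negP => H.
by apply: (top (Ordinal h, c.2)); rewrite /in_diagram /before /= ?eqxx ?ltnSn ?orbT //; lia.
Qed.

(** Inserting the largest entry in the new box and erasing it are inverse
    bijections, because fillings of shape l carry the default value there. *)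
Lemma card_standard_max_at l i (h : (l i < N)%N) (m : 'I_N.+1) :
  addable l i -> m = num_boxes l :> nat ->
  (num_boxes l < N)%N ->
  #|[set T | standard (l + box i) T & T (i, Ordinal h) == m]| = num_standard l.
Proof.
move=> g mE sl; rewrite /num_standard.
have dcn : in_diagram l (i, Ordinal h) = false by rewrite /in_diagram /= ltnn.
have -> : [set T | standard (l + box i) T & T (i, Ordinal h) == m] =
  (fun T => set_entry T (i, Ordinal h) m) @: [set T | standard l T].
  apply/setP => T; rewrite inE; apply/andP/imsetP => [[sT /eqP Tm]|[T' ]].
    exists (set_entry T (i, Ordinal h) ord_max); first by
      rewrite inE; apply: standard_del_box mE _ _ _.
    by apply/ffunP => c; rewrite !ffunE; case: eqP => [->|].
  by rewrite inE => sT ->; rewrite ffunE eqxx; split=> //; apply: standard_add_box.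
apply: card_in_imset => T T'; rewrite !inE => sT sT' /ffunP E.
apply/ffunP => c; have := E c; rewrite !ffunE; case: eqP => [->|//] _.
have [_ HT _ _ _] := standardP _ _ sT; have [_ HT' _ _ _] := standardP _ _ sT'.
by rewrite HT ?HT' ?dcn.
Qed.

(** Sort the tableaux of shape l by the row of their largest entry. *)
Lemma branching l : noninc l -> (0 < num_boxes l <= N)%N ->
  num_standard l = (\sum_(i | addable (l - box i)%R i) num_standard (l - box i)%R)%N.
Proof.
move=> nl /andP[l0 lN].
have mP : ((num_boxes l).-1 < N.+1)%N by lia.
pose m := Ordinal mP; have mN : (m < N)%N by rewrite /=; lia.
have sz : num_boxes l = m.+1 by rewrite /=; lia.
have szi i : addable (l - box i) i -> num_boxes (l - box i) = m.
  by move/num_boxes_addable; rewrite subrK sz => -[].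
pose at_row i T := [exists j : 'I_N, (j == (l - box i) i :> nat) && (T (i, j) == m)].
transitivity (\sum_(i | addable (l - box i)%R i) #|[set T | standard l T & at_row i T]|)%N;
  last first.
  apply: eq_bigr => i g; have /and3P[_ _ h] := g.
  rewrite -(card_standard_max_at h (m := m) g) ?szi //; apply: eq_card => T; rewrite !inE subrK.
  congr andb; apply/existsP/eqP => [[j /andP[/eqP E /eqP <-]]|E].
    by congr (T (_, _)); apply: val_inj.
  by exists (Ordinal h); rewrite E !eqxx.
rewrite /num_standard -sum1_card.
under [RHS]eq_bigr => i _ do rewrite -sum1_card big_mkcond /=.
rewrite exchange_big /= big_mkcond; apply: eq_bigr => T _; rewrite inE.
case: (boolP (standard l T)) => sT; last by rewrite big1 // => i _; rewrite inE (negbTE sT).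
have [Hin Hout Hsurj Hinj Hinc] := standardP _ _ sT.
have [c /= Ec] := Hsurj (Ordinal mN) ltac:(rewrite /= sz //).
have Tc : T c = m by apply: val_inj.
have /andP[g E] := max_corner nl sz mN sT Tc.
rewrite (bigD1 c.1) //= inE sT /=.
have -> : at_row c.1 T.
  by apply/existsP; exists c.2; rewrite E -Tc; case: (c) => a b /=.
rewrite big1 // => i /andP[gi ne]; rewrite inE sT /=.
case: (boolP (at_row i T)) => // /existsP[j /andP[_ /eqP Tj]].
have dd d : T d = m -> in_diagram l d.
  by case: (boolP (in_diagram l d)) => // /Hout -> Em; rewrite -Em /= ltnn in mN.
have Eq := Hinj _ _ (dd _ Tc) (dd _ Tj) (etrans Tc (esym Tj)).
by rewrite Eq eqxx in ne.
Qed.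
End Tableaux.

(** * The weighted sum of squares *)

Section Sums.
Variables (N : nat) (R : comNzRingType) (x : R).
Notation shape := {ffun 'I_N -> 'I_N.+1}.
Implicit Types (l : shape) (i j : 'I_N).

(** As an identity between polynomials in x of degree 1, this says that the
    numbers f(l + b) add up to (|l| + 1) f(l), and that the contents of the
    added boxes b, weighted by f(l + b), cancel. *)
Lemma weighted_branching_up l : noninc l -> (num_boxes l < N)%N ->
  \sum_(i | addable l i) weight x l i * (num_standard (l + box i))%:R
  = x * (num_boxes l).+1%:R * (num_standard l)%:R.
Proof.
move: {2}(num_boxes l).+1 (ltnSn (num_boxes l)) => s; elim: s l => // s IH l ls nl sl.
have down_lt j : addable (l - box j) j -> (num_boxes (l - box j)).+1 = num_boxes l.
  by move/num_boxes_addable; rewrite subrK.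
(* Removing the box i that was just added is split off from the other removals. *)
transitivity (\sum_(i | addable l i) weight x l i * (num_standard l)%:R +
   \sum_(i | addable l i) \sum_(j | (j != i) && addable (l + box i - box j) j)
     weight x l i * (num_standard (l + box i - box j))%:R).
  rewrite -big_split /=; apply: eq_bigr => i g.
  have /and3P[_ nu _] := g.
  rewrite branching ?num_boxes_addable // natr_sum mulr_sumr (bigD1 i) /=; last by rewrite addrK.
  rewrite addrK; congr (_ + _); apply: eq_bigl => j; exact: andbC.
(* Remove the box j first, and then add the box i. *)
have -> : \sum_(i | addable l i) \sum_(j | (j != i) && addable (l + box i - box j) j)
     weight x l i * (num_standard (l + box i - box j))%:R =
   \sum_(j | addable (l - box j) j) \sum_(i | (i != j) && addable (l - box j) i)
     weight x (l - box j) i * (num_standard (l - box j + box i))%:R.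
  rewrite (exchange_big_dep xpredT) //= [RHS]big_mkcond /=; apply: eq_bigr => j _.
  case: ifP => gj; last first.
    rewrite big_pred0 // => i; rewrite andbCA; case: eqP => //= /eqP ji.
    by rewrite addable_exchange ?gj // eq_sym.
  apply: eq_big => [i|i /and3P[_ ji _]].
    rewrite andbCA eq_sym; have [//|/= ij] := eqVneq i j.
    by rewrite addable_exchange // gj.
  have lj : (0 < l j)%N by move: gj; rewrite removableE // !row_length_ord; lia.
  by rewrite addrAC /weight sub_boxE // eq_sym (negbTE ji) subn0.
(* The inner sum is the induction hypothesis for l - box j, without the term i = j. *)
rewrite [X in _ + X](eq_bigr (fun j => x * (num_boxes l)%:R * (num_standard (l - box j))%:R
   - weight x (l - box j) j * (num_standard l)%:R)); last first.
  move=> j gj; have /and3P[nj _ _] := gj; have sj := down_lt j gj.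
  have := IH (l - box j) _ nj _; rewrite sj => <-; try by lia.
  by rewrite [in RHS](bigD1 j) //= subrK addrAC subrr add0r; apply: eq_bigl => i; rewrite andbC.
rewrite sumrB -!mulr_suml -mulr_sumr.
have -> : x * (num_boxes l)%:R * \sum_(j | addable (l - box j) j) (num_standard (l - box j))%:R
  = x * (num_boxes l)%:R * (num_standard l)%:R.
  have [->|l0] := posnP (num_boxes l); first by rewrite mulr0 !mul0r.
  by rewrite [in RHS]branching ?natr_sum // l0 ltnW.
rewrite addrCA -mulrBl content_balance // -natr1; ring.
Qed.

Definition content_prod l : R := \prod_(i < N) \prod_(0 <= k < l i) (x + i%:R - k%:R).

Lemma content_prod_add_box l i : (l i < N)%N ->
  content_prod (l + box i) = content_prod l * weight x l i.
Proof.
move=> li; rewrite /content_prod (bigD1 i) //= [in RHS](bigD1 i) //= add_boxE // eqxx addn1.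
rewrite big_nat_recr //= mulrAC; congr (_ * _ * _).
by apply: eq_bigr => j /negbTE ji; rewrite add_boxE // ji addn0.
Qed.

Lemma num_boxes_eq0 l : num_boxes l = 0%N -> l = 0.
Proof.
move=> l0; apply/ffunP => i; apply: val_inj; rewrite /= ffunE /=.
by have := leq_num_boxes l i; rewrite l0 leqn0 => /eqP.
Qed.

Lemma num_standard0 : num_standard (0 : shape) = 1%N.
Proof.
have s0 : num_boxes (0 : shape) = 0%N by rewrite /num_boxes big1 // => i _; rewrite ffunE.
have d0 c : in_diagram (0 : shape) c = false by rewrite /in_diagram ffunE.
rewrite /num_standard (_ : [set T | _] = [set [ffun=> ord_max]]) ?cards1 //.
apply/setP => T; rewrite !inE; apply/standardP/eqP => [[_ H _ _ _]|->].
  by apply/ffunP => c; rewrite ffunE H ?d0.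
by split=> [c|c|k|c d|c d]; rewrite ?d0 ?s0 // ffunE.
Qed.

(** The coefficient of x^m gives the Robinson-Schensted identity
    that the f(l)^2 with |l| = m add up to m!. *)
Lemma weighted_square_sum m : (m <= N)%N ->
  \sum_(l : shape | noninc l && (num_boxes l == m))
     (num_standard l)%:R ^+ 2 * content_prod l = (m`!)%:R * x ^+ m.
Proof.
elim: m => [_|m IH mN].
  rewrite (big_pred1 (0 : shape)) => [|l]; last first.
    apply/andP/eqP => [[_ /eqP/num_boxes_eq0]//|->]; split.
      by apply/nonincP => i j _; rewrite !ffunE.
    by rewrite /num_boxes big1 // => i _; rewrite ffunE.
  rewrite num_standard0 /content_prod big1 ?expr0 ?expr1n ?mulr1 // => i _.
  by rewrite ffunE /= big_geq.
transitivity (\sum_(i < N)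
   \sum_(l : shape | [&& noninc l, num_boxes l == m.+1 & addable (l - box i) i])
   (num_standard l)%:R * content_prod l * (num_standard (l - box i))%:R).
  rewrite (exchange_big_dep (fun l : shape => noninc l && (num_boxes l == m.+1))) /=; last first.
    by move=> i l _ /and3P[-> ->].
  apply: eq_bigr => l /andP[nl /eqP sl].
  rewrite expr2 mulrAC {2}branching ?sl // natr_sum mulr_sumr; apply: eq_bigl => i.
  by rewrite nl eqxx.
transitivity (\sum_(i < N) \sum_(l : shape | [&& noninc l, num_boxes l == m & addable l i])
   (num_standard (l + box i))%:R * (content_prod l * weight x l i) * (num_standard l)%:R).
  apply: eq_bigr => i _; rewrite (reindex_inj (addIr (box i))) /=; apply: eq_big => l.
    rewrite addrK; case: (boolP (addable l i)) => [g|]; last by rewrite !andbF.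
    by rewrite num_boxes_addable // eqSS; case/and3P: g => -> ->.
  by rewrite addrK => /and3P[_ _ /and3P[_ _ li]]; rewrite content_prod_add_box.
rewrite (exchange_big_dep (fun l : shape => noninc l && (num_boxes l == m))) /=; last first.
  by move=> i l _ /and3P[-> ->].
transitivity (\sum_(l : shape | noninc l && (num_boxes l == m))
   x * m.+1%:R * ((num_standard l)%:R ^+ 2 * content_prod l)).
  apply: eq_bigr => l /andP[nl /eqP sl].
  transitivity ((num_standard l)%:R * content_prod l *
    (x * (num_boxes l).+1%:R * (num_standard l)%:R));
    last by rewrite sl expr2; ring.
  rewrite -weighted_branching_up ?sl // mulr_sumr; apply: eq_big => [i|i _]; last by ring.
  by rewrite nl eqxx.
by rewrite -mulr_sumr IH ?factS ?natrM ?exprS; [ring|lia].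
Qed.
End Sums.

(** * Specialisation to x = n + 1 *)

Lemma num_standard_num_syt n (l : {ffun 'I_n -> 'I_n.+1}) : num_boxes l = n ->
  num_standard l = num_syt l.
Proof.
move=> sl.
pose ext (T : {ffun cell l -> 'I_n}) : {ffun 'I_n * 'I_n -> 'I_n.+1} :=
  [ffun c => if insub c is Some d then widen_ord (leqnSn n) (T d) else ord_max].
have extE T (d : cell l) : ext T (val d) = T d :> nat by rewrite ffunE valK.
have ext_out T c : ~~ in_diagram l c -> ext T c = ord_max.
  by move=> h; rewrite ffunE insubN.
rewrite /num_standard /num_syt -(card_in_imset (f := ext)); last first.
  move=> T T' _ _ E; apply/ffunP => d; apply: val_inj.
  by rewrite /= -!extE E.
apply: eq_card => U; rewrite !inE; apply/standardP/imsetP => [[Hin Hout Hsurj Hinj Hinc]|[T]].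
  have lt (d : cell l) : (U (val d) < n)%N by rewrite -[X in (_ < X)%N]sl Hin // (valP d).
  pose T : {ffun cell l -> 'I_n} := [ffun d => Ordinal (lt d)].
  exists T; last first.
    apply/ffunP => c; rewrite ffunE; case: insubP => [d _ <-|/Hout //].
    by apply: val_inj; rewrite /= ffunE.
  rewrite inE; apply/and4P; split.
  - apply/injectiveP => c d; rewrite !ffunE => /(congr1 val) /= E; apply: val_inj.
    by apply: Hinj (valP c) (valP d) _; apply: val_inj.
  - apply/forallP => k; have [|c E] := Hsurj k; first by rewrite sl.
    have dc : in_diagram l c.
      by case: (boolP (in_diagram l c)) => // /Hout Ec; move: (ltn_ord k); rewrite -E Ec ltnn.
    by apply/existsP; exists (Sub c dc); rewrite ffunE -val_eqE /= E.
  - apply/forallP => c; apply/forallP => d; apply/implyP => h; rewrite !ffunE /=.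
    by apply: Hinc (valP c) (valP d) _; rewrite /before h.
  apply/forallP => c; apply/forallP => d; apply/implyP => h; rewrite !ffunE /=.
  by apply: Hinc (valP c) (valP d) _; rewrite /before h orbT.
rewrite inE => /and4P[/injectiveP Tinj /forallP Tsurj /forallP Trow /forallP Tcol] ->.
have sub c : in_diagram l c -> exists d : cell l, c = val d.
  by move=> dc; exists (Sub c dc).
split.
- by move=> _ /sub[d ->]; rewrite extE sl.
- exact: ext_out.
- by move=> k _; have /existsP[c /eqP <-] := Tsurj k; exists (val c); rewrite extE.
- move=> _ _ /sub[c ->] /sub[d ->] /(congr1 val) /=; rewrite !extE => E.
  by congr val; apply: Tinj; apply: val_inj.
move=> _ _ /sub[c ->] /sub[d ->] /orP[] h; rewrite !extE.
  by have /forallP/(_ d)/implyP := Trow c; apply.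
by have /forallP/(_ d)/implyP := Tcol c; apply.
Qed.

Lemma prod_falling (R : numFieldType) (M k : nat) : (k <= M)%N ->
  \prod_(0 <= r < k) (M%:R - r%:R) = M`!%:R / (M - k)`!%:R :> R.
Proof.
move=> kM; have nz : (M - k)`!%:R != 0 :> R by rewrite pnatr_eq0 -lt0n fact_gt0.
apply: (canRL (mulfK nz)); rewrite -(ffact_fact kM) natrM; congr (_ * _).
elim: k kM {nz} => [_|k IH kM]; first by rewrite big_geq.
rewrite big_nat_recr //.
rewrite IH; last exact: ltnW.
by rewrite ffactnSr natrM natrB; last exact: ltnW.
Qed.

Theorem corollary2p10 (n : nat) (n_gt0 : (0 < n)%N) :
  \sum_(l : {ffun 'I_n -> 'I_n.+1} | is_partition l)
     (num_syt l)%:R ^+ 2 *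
     \prod_(i < n) ((n + i.+1)`!%:R / (n + i.+1 - l i)`!%:R)
  = ((n + 1) ^ n * n`!)%:R :> rat.
Proof.
transitivity (\sum_(l : {ffun 'I_n -> 'I_n.+1} | noninc l && (num_boxes l == n))
     (num_standard l)%:R ^+ 2 * content_prod (n + 1)%:R l : rat).
  apply: eq_bigr => l /andP[_ /eqP sl]; rewrite num_standard_num_syt //; congr (_ * _).
  apply: eq_bigr => i _; rewrite -prod_falling; last first.
    by rewrite -ltnS (leq_trans (ltn_ord (l i))) // ltnS leq_addr.
  by apply: eq_bigr => k _; rewrite -natrD addn1 addSnnS.
by rewrite weighted_square_sum // natrM natrX mulrC.
Qed.
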